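(* Let $\mathbf{A}\in\mathbb{R}^{m\times n}$ with $m<n$, let $\mathbf{D}\in\mathbb{R}^{n\times N}$, let $x^*\in\mathbb{R}^n$, and let $I=\operatorname{supp}(\mathbf{D}^T x^* )\subset\{1,\dots,N\}$. Then $x^*$ is the unique solution of $$\min_{y\in\mathbb{R}^n}\|\mathbf{D}^T y\|_1\quad\text{subject to}\quad \mathbf{A}y=\mathbf{A}x^*$$ if and only if $$\ker(\mathbf{A})\cap\ker(\mathbf{D}_{I^c}^T)=\{0\}$$ and there exist $w\in\mathbb{R}^m$ and $v\in\mathbb{R}^N$ such that $$\mathbf{D}v=\mathbf{A}^T w,\qquad v_I=\operatorname{sign}(\mathbf{D}_I^T x^* ),\qquad \|v_{I^c}\|_\infty<1.$$
   Context: For a vector $z$, $\operatorname{supp}(z)$ is the set of indices of its nonzero entries, and $\operatorname{sign}$ is applied entrywise. For an index set $I\subset\{1,\dots,N\}$, $I^c=\{1,\dots,N\}\setminus I$; $\mathbf{D}_I$ is the submatrix of $\mathbf{D}$ consisting of the columns indexed by $I$, $\mathbf{D}_I^T$ is the transpose of this submatrix, and $v_I$ is the restriction of the vector $v$ to the entries indexed by $I$ (similarly for $I^c$). If $I^c=\emptyset$, then $\ker(\mathbf{D}_{I^c}^T)=\mathbb{R}^n$ and $\|v_{I^c}\|_\infty=0$. $\|\cdot\|_1$ and $\|\cdot\|_\infty$ are the usual $\ell^1$- and $\ell^\infty$-norms. *)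

(* Defs.v *)
From mathcomp Require Import all_boot all_order all_algebra.
From mathcomp Require Import classical_sets reals.
From mathcomp Require Import normedtype.

Set Implicit Arguments.
Unset Strict Implicit.
Unset Printing Implicit Defensive.

Import Order.TTheory GRing.Theory Num.Theory.
Import numFieldNormedType.Exports.

Local Open Scope ring_scope.

Definition vsupp (R : realType) (N : nat) (z : 'cV[R]_N) : {set 'I_N} :=
  [set i | z i 0 != 0].

(* The indices of I are listed in increasing order by [enum_val]; when I is
   empty, both constructions have a dimension equal to 0. *)
Definition colsI (R : realType) (n N : nat) (I : {set 'I_N})
    (D : 'M[R]_(n, N)) : 'M[R]_(n, #|I|) :=
  colsub (fun k : 'I_#|I| => enum_val k) D.

Definition entriesI (R : realType) (N : nat) (I : {set 'I_N})
    (v : 'cV[R]_N) : 'cV[R]_#|I| :=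
  rowsub (fun k : 'I_#|I| => enum_val k) v.

Definition vsign (R : realType) (k : nat) (z : 'cV[R]_k) : 'cV[R]_k :=
  map_mx Num.sg z.

(* Kernel of the map y |-> M y on column vectors ([kermx] is the kernel of the
   action on row vectors). *)
Definition colker (R : realType) (k n : nat) (M : 'M[R]_(k, n)) :
    set 'cV[R]_n :=
  [set y | M *m y = 0]%classic.

Definition norm1 (R : realType) (k : nat) (z : 'cV[R]_k) : R :=
  \sum_(i < k) `|z i 0|.

(* The library norm on matrices, [mx_norm], is the maximum of the absolute
   values of the entries, and is 0 when there are none. *)
Definition norm_inf (R : realType) (k : nat) (z : 'cV[R]_k) : R := `|z|.

Definition is_minimizer (R : realType) (T : Type) (C : set T) (f : T -> R)
    (x : T) : Prop :=
  C x /\ forall y, C y -> f x <= f y.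

Definition is_unique_minimizer (R : realType) (T : Type) (C : set T)
    (f : T -> R) (x : T) : Prop :=
  is_minimizer C f x /\ forall y, is_minimizer C f y -> y = x.

(* Main.v *)
(** Put [p h = sum_{i in I} sign((D^T x)_i) (D^T h)_i + sum_{i notin I} |(D^T h)_i|];
    for small [t > 0] the objective at [x + t h] is [||D^T x||_1 + t p(h)], so
    uniqueness of the minimizer forces [p > 0] on [ker A \ {0}].  By compactness
    of the unit sphere, [p] stays nonnegative when the second sum is multiplied
    by a suitable [rho < 1].  Let [y] be the element of least Euclidean norm in
    the compact convex set of the [B D v], where the rows of [B] form a basis of
    [ker A] and [v] is fixed to the signs on [I] and bounded by [rho] off [I].
    Choosing [v] extremal for the direction [-y] gives [-<y, B D v> >= 0], while
    minimality gives [<y, B D v> >= |y|^2]; hence [y = 0], so [D v] is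
    orthogonal to [ker A] and lies in the range of [A^T]. *)

Require Import Defs.
From mathcomp Require Import all_boot all_order all_algebra.
From mathcomp Require Import classical_sets reals.
From mathcomp Require Import topology normedtype derive.
From mathcomp Require Import ring lra.

Import Order.TTheory GRing.Theory Num.Theory.
Import numFieldNormedType.Exports.

Local Open Scope ring_scope.

(** * Continuity, and least-norm points of compact convex sets *)

Lemma continuous_sum (R : realType) (T : topologicalType) (J : Type)
    (r : seq J) (P : pred J) (F : J -> T -> R) :
  (forall i, P i -> continuous (F i)) ->
  continuous (fun x => \sum_(i <- r | P i) F i x).
Proof. by move=> cF; apply: continuous_big => //; exact: add_continuous. Qed.

Lemma continuous_mulmx_coord (R : realType) (N r : nat) (M : 'M[R]_(N, r))
    (k : 'I_r) : continuous (fun v : 'rV[R]_N => (v *m M) 0 k).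
Proof.
have -> : (fun v : 'rV[R]_N => (v *m M) 0 k) =
          (fun v => \sum_j v 0 j * M j k).
  by apply: boolp.funext => v; rewrite mxE.
apply: continuous_sum => j _ x; apply: continuousM; last exact: cst_continuous.
exact: coord_continuous.
Qed.

(** If [b < 0], the value [t = - b / (|c| - b)] gives [b + c t <= b t < 0]. This yields the
    first-order condition at a minimum along a segment. *)
Lemma ge0_quadratic_near0 (R : realFieldType) (b c : R) :
  (forall t, 0 < t <= 1 -> 0 <= b * t + c * t ^+ 2) -> 0 <= b.
Proof.
move=> H; rewrite leNgt; apply/negP => b0.
pose t := - b / (`|c| - b).
have c0 : 0 <= `|c| by [].
have d0 : 0 < `|c| - b by lra.
have t0 : 0 < t by apply: divr_gt0 => //; lra.
have t1 : t <= 1 by rewrite ler_pdivrMr //; lra.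
have := H t; rewrite t0 t1 => /(_ isT).
rewrite expr2 (mulrA c) -mulrDl pmulr_lge0 //.
have ct : c * t <= `|c| * t by rewrite ler_pM2r // ler_norm.
have e : `|c| * t - b * t = - b by rewrite -mulrBl mulrC divfK // gt_eqF.
have bt : b * t < 0 by rewrite nmulr_rlt0.
lra.
Qed.

(* The point of least Euclidean norm of the image of [V] is [0]: otherwise its
   opposite would be a direction [z] that is negative on the whole image. *)
Lemma compact_convex_kernel (R : realType) (r N : nat) (M : 'M[R]_(N, r))
    (V : set 'rV[R]_N) :
  compact V ->
  (forall u v (t : R), V u -> V v -> 0 < t <= 1 -> V (u + t *: (v - u))) ->
  (forall z : 'rV[R]_r, exists2 v, V v & 0 <= \sum_k (v *m M) 0 k * z 0 k) ->
  exists2 v, V v & v *m M = 0.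
Proof.
move=> cV convV sepV.
pose f (v : 'rV[R]_N) := \sum_k (v *m M) 0 k ^+ 2.
have [v0 Vv0 _] := sepV 0.
have [||u /set_mem Vu minu] := @EVT_min_rV R N f V _ cV; first by exists v0.
  apply: continuous_subspaceT; apply: continuous_sum => k _ x.
  by apply: continuousM; exact: continuous_mulmx_coord.
exists u => //.
have [v Vv vz] := sepV (- (u *m M)).
(* Expanding [f (u + t (v - u)) - f u] in [t] leaves this linear coefficient and the quadratic one
   [f (v - u)]. *)
have var : 0 <= 2 * (\sum_k (u *m M) 0 k * ((v - u) *m M) 0 k).
  apply: (@ge0_quadratic_near0 _ _ (f (v - u))) => t t01.
  have := minu _ (mem_set (convV u v t Vu Vv t01)).
  rewrite -subr_ge0 /f mulrC !mulr_sumr !mulr_suml -sumrB -big_split /=.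
  congr (0 <= _); apply: eq_bigr => k _.
  rewrite mulmxDl -scalemxAl !mxE; ring.
have fu : f u <= 0.
  have e : \sum_k (v *m M) 0 k * (- (u *m M)) 0 k =
      - (\sum_k (u *m M) 0 k * ((v - u) *m M) 0 k) - f u.
    rewrite -sumrN -sumrB; apply: eq_bigr => k _.
    rewrite mulmxBl !mxE; ring.
  rewrite e in vz; lra.
have f0 : f u == 0 by rewrite eq_le fu sumr_ge0 // => k _; exact: sqr_ge0.
apply/rowP => k; rewrite [RHS]mxE; apply/eqP.
move: f0; rewrite psumr_eq0; last by move=> ? _; exact: sqr_ge0.
by move=> /allP/(_ k (mem_index_enum _)); rewrite /= sqrf_eq0.
Qed.

(** The box is compact and convex, and [(v M) z = v (M z)] identifies the two pairings. Intervals
    with [a i = b i] serve to freeze coordinates. *)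
Lemma box_kernel (R : realType) (r N : nat) (M : 'M[R]_(N, r))
    (a b : 'I_N -> R) :
  (forall z : 'cV[R]_r, exists2 v : 'rV[R]_N,
      (forall i, a i <= v 0 i <= b i) & 0 <= \sum_i v 0 i * (M *m z) i 0) ->
  exists2 v : 'rV[R]_N, (forall i, a i <= v 0 i <= b i) & v *m M = 0.
Proof.
move=> H; pose V := [set v : 'rV[R]_N | forall i, `[a i, b i]%classic (v 0 i)]%classic.
have VE v : V v <-> forall i, a i <= v 0 i <= b i.
  by split=> Vv i; move: (Vv i); rewrite /= in_itv.
have [||z|v /VE Vv vM] := @compact_convex_kernel R r N M V.
- apply: (@rV_compact R N (fun i => `[a i, b i]%classic)) => i.
  exact: segment_compact.
- move=> u v t /VE Vu /VE Vv /andP[t0 t1]; apply/VE => i.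
  rewrite !mxE; move: (Vu i) (Vv i) => /andP[? ?] /andP[? ?].
  by apply/andP; split; nra.
- have [v Vv vz] := H z^T; exists v; first exact/VE.
  have -> // : \sum_k (v *m M) 0 k * z 0 k = \sum_i v 0 i * (M *m z^T) i 0.
  have <- : (v *m M *m z^T) 0 0 = \sum_k (v *m M) 0 k * z 0 k.
    by rewrite mxE; apply: eq_bigr => k _; rewrite [z^T _ _]mxE.
  by rewrite -mulmxA mxE.
by exists v.
Qed.

(** * A uniform gap on the unit sphere, and the strict sign vector *)

Lemma sphere_compact (R : realType) (r : nat) :
  compact [set z : 'rV[R]_r | `|z| = 1]%classic.
Proof.
apply: bounded_closed_compact.
  by exists 1; split => // x x1 z /= ->; exact: ltW.
have -> : [set z : 'rV[R]_r | `|z| = 1]%classic =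
          ((fun z : 'rV[R]_r => `|z|) @^-1` [set 1])%classic by [].
apply: preimage_closed; last exact: closed_eq.
by move=> z _; exact: norm_continuous.
Qed.

(* [rho = M / (M + c)], where [c] is the minimum of [l + q] and [M] the maximum
   of [q] on the unit sphere. *)
Lemma homogeneous_gap (R : realType) (r : nat) (l q : 'rV[R]_r -> R) :
  continuous l -> continuous q -> (forall z, 0 <= q z) ->
  (forall (t : R) (z : 'rV[R]_r), 0 <= t -> l (t *: z) = t * l z) ->
  (forall (t : R) (z : 'rV[R]_r), 0 <= t -> q (t *: z) = t * q z) ->
  (forall z : 'rV[R]_r, z != 0 -> 0 < l z + q z) ->
  exists2 rho, 0 <= rho < 1 & forall z, 0 <= l z + rho * q z.
Proof.
move=> cl cq q0 hl hq pos.
pose S := [set z : 'rV[R]_r | `|z| = 1]%classic.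
have zE (z : 'rV[R]_r) : z != 0 -> z = `|z| *: (`|z|^-1 *: z).
  by move=> z0; rewrite scalerA divff ?normr_eq0 // scale1r.
have Sn (z : 'rV[R]_r) : z != 0 -> S (`|z|^-1 *: z).
  by move=> z0; rewrite /S /= normrZ ger0_norm ?invr_ge0 // mulVf ?normr_eq0.
have l0 : l 0 = 0 by rewrite -(scale0r 0) hl // mul0r.
have qq0 : q 0 = 0 by rewrite -(scale0r 0) hq // mul0r.
(* An empty sphere leaves only [z = 0], where both functions vanish. *)
have [[z0 Sz0]|S0] := boolp.pselect (S !=set0)%classic; last first.
  exists 0; first by rewrite lexx ltr01.
  move=> z; have [->|z0] := eqVneq z 0; first by rewrite l0 mul0r addr0.
  by case: S0; exists (`|z|^-1 *: z); exact: Sn.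
have [||a /set_mem Sa mina] :=
    @EVT_min_rV R r (fun z => l z + q z) S _ (@sphere_compact R r).
  by exists z0.
  apply: continuous_subspaceT => z; apply: continuousD; [exact: cl|exact: cq].
have [||b /set_mem Sb maxb] := @EVT_max_rV R r q S _ (@sphere_compact R r).
  by exists z0.
  exact: continuous_subspaceT.
have c0 : 0 < l a + q a.
  by apply: pos; rewrite -normr_eq0 (Sa : `|a| = 1) oner_eq0.
have M0 := q0 b; set c := l a + q a in c0 mina *.
have d0 : 0 < q b + c by lra.
exists (q b / (q b + c)).
  apply/andP; split; first by apply: divr_ge0 => //; exact: ltW.
  by rewrite ltr_pdivrMr // mul1r; lra.
move=> z; have [->|zn0] := eqVneq z 0; first by rewrite l0 qq0 mulr0 addr0.
rewrite (zE z zn0) hl // hq //.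
rewrite mulrCA -mulrDr mulr_ge0 //; set w := _ *: z.
have Sw : w \in S by apply/mem_set/Sn.
have := mina _ Sw; have := maxb _ Sw => ? ?.
have := q0 w => ?.
(* With [M = q b], multiplying by [M + c] gives [(M + c) (l w + q w) - c q w >= c^2]. *)
rewrite -(pmulr_lge0 _ d0) mulrDl mulrAC divfK ?gt_eqF //.
nra.
Qed.

(** This produces the dual certificate: the box fixes [s] on [I] and allows [[- rho, rho]] off [I],
    where [rho < 1] makes the bound strict. *)
Lemma strict_sign_kernel (R : realType) (r N : nat) (M : 'M[R]_(N, r))
    (I : {set 'I_N}) (s : 'I_N -> R) :
  (forall z : 'cV[R]_r, z != 0 ->
    0 < \sum_(i in I) s i * (M *m z) i 0 + \sum_(i in ~: I) `|(M *m z) i 0|) ->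
  exists v : 'rV[R]_N, [/\ forall i, i \in I -> v 0 i = s i,
    forall i, i \in ~: I -> `|v 0 i| < 1 & v *m M = 0].
Proof.
move=> pos.
have gE (z : 'rV[R]_r) i : (M *m z^T) i 0 = (z *m M^T) 0 i.
  by rewrite -[z in RHS]trmxK -trmx_mul [RHS]mxE.
have cg i : continuous (fun z : 'rV[R]_r => (M *m z^T) i 0).
  under boolp.eq_fun do rewrite gE; exact: continuous_mulmx_coord.
have gZ t (z : 'rV[R]_r) i : (M *m (t *: z)^T) i 0 = t * (M *m z^T) i 0.
  by rewrite linearZ /= -scalemxAr [LHS]mxE.
have [||||||rho /andP[rho0 rho1] Hrho] := @homogeneous_gap R r
    (fun z => \sum_(i in I) s i * (M *m z^T) i 0)
    (fun z => \sum_(i in ~: I) `|(M *m z^T) i 0|).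
- apply: continuous_sum => i _ x; apply: continuousM; [exact: cst_continuous|exact: cg].
- apply: continuous_sum => i _ x; apply: continuous_comp; first exact: cg.
  exact: norm_continuous.
- by move=> z; exact: sumr_ge0.
- move=> t z t0; rewrite mulr_sumr; apply: eq_bigr => i _.
  by rewrite gZ mulrCA.
- move=> t z t0; rewrite mulr_sumr; apply: eq_bigr => i _.
  by rewrite gZ normrM ger0_norm.
- by move=> z z0; apply: pos; apply: contraNneq z0 => /(congr1 trmx); rewrite trmxK trmx0 => ->.
pose a i := if i \in I then s i else - rho.
pose b i := if i \in I then s i else rho.
have [z|v vab vM] := @box_kernel R r N M a b.
  (* This point of the box maximizes the pairing with [M *m z]; its value is the sum that [Hrho]
     bounds below by 0. *)
  exists (\row_i if i \in I then s i else rho * Num.sg ((M *m z) i 0)).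
    move=> i; rewrite mxE /a /b; case: ifP => _; first by rewrite lexx.
    rewrite -ler_norml normrM ger0_norm // normr_sg.
    by case: (_ != 0); rewrite ?mulr1 ?mulr0.
  have := Hrho z^T; rewrite trmxK.
  rewrite [X in _ -> 0 <= X](bigID [in I]) /= mulr_sumr.
  congr (0 <= _ + _); first by apply: eq_bigr => i iI; rewrite mxE iI.
  apply: eq_big => [i|i]; first by rewrite inE.
  by rewrite inE => /negbTE iI; rewrite mxE iI -mulrA -normrEsg.
exists v; split=> // i; have := vab i; rewrite /a /b ?inE.
  by move=> /[swap] -> ; rewrite -eq_le => /eqP ->.
by move=> /[swap] /negbTE ->; rewrite -ler_norml => /le_lt_trans; apply.
Qed.

(** The row space of [A] lies in its double annihilator, and both have the rank of [A], so they
    coincide. *)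
Lemma mulmx_kermx_tr (F : fieldType) (m n p : nat) (A : 'M[F]_(m, n))
    (u : 'M[F]_(p, n)) :
  u *m (kermx A^T)^T = 0 -> (u <= A)%MS.
Proof.
move/eqP; rewrite -sub_kermx => /submx_trans; apply.
have sub : (A <= kermx (kermx A^T)^T)%MS.
  by rewrite sub_kermx -[X in X *m _]trmxK -trmx_mul mulmx_ker trmx0.
have [_ <-] := mxrank_leqif_sup sub.
by rewrite mxrank_ker mxrank_tr mxrank_ker mxrank_tr subKn // rank_leq_col.
Qed.

(** * Expansion of the l1 norm, and restriction to an index set *)

(** The sum [x + d] keeps the weak sign of [x], so the absolute value is affine there. *)
Lemma norm_perturb (R : realDomainType) (x d : R) :
  `|d| <= `|x| -> `|x + d| = `|x| + Num.sg x * d.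
Proof.
have [x0|x0|->] := ltgtP x 0.
- rewrite (ltr0_norm x0) (ltr0_sg x0) ler_norml => /andP[? ?].
  by rewrite ler0_norm ?opprD ?mulN1r //; lra.
- rewrite (gtr0_norm x0) (gtr0_sg x0) ler_norml => /andP[? ?].
  by rewrite ger0_norm ?mul1r //; lra.
- by rewrite normr0 normr_le0 => /eqP ->; rewrite addr0 normr0 mulr0 addr0.
Qed.

(** The sum of the ratios [|g i| / |z i|] bounds each of them; adding 1 keeps the inverse defined
    when that sum is 0. *)
Lemma exists_small_scale (R : realFieldType) (T : finType) (P : pred T)
    (z g : T -> R) :
  (forall i, P i -> z i != 0) ->
  exists2 t, 0 < t & forall i, P i -> `|t * g i| <= `|z i|.
Proof.
move=> z0; pose S := \sum_(i | P i) `|g i| / `|z i|.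
have S0 : 0 <= S by apply: sumr_ge0 => i _; exact: divr_ge0.
have d0 : 0 < 1 + S by lra.
exists (1 + S)^-1; first by rewrite invr_gt0.
move=> i Pi; rewrite normrM gtr0_norm ?invr_gt0 // mulrC ler_pdivrMr // mulrC.
rewrite -ler_pdivrMr ?normr_gt0 ?z0 // /S (bigD1 i) //=.
have : 0 <= \sum_(j | P j && (j != i)) `|g j| / `|z j|.
  by apply: sumr_ge0 => j _; exact: divr_ge0.
set u := _ / _; lra.
Qed.

(** Positivity of [e] covers the empty vector, whose norm is 0. *)
Lemma norm_inf_lt (R : realType) (k : nat) (z : 'cV[R]_k) (e : R) : 0 < e ->
  norm_inf z < e <-> forall i, `|z i 0| < e.
Proof.
move=> e0; rewrite /norm_inf /Num.norm /= mx_normrE; split.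
  by move=> /bigmax_ltP[_ H] i; exact: (H (i, 0) isT).
by move=> H; apply: bigmax_lt => // -[i j] _; rewrite /= ord1; exact: H.
Qed.

Lemma entriesI_eqP (R : realType) (N : nat) (I : {set 'I_N})
    (u v : 'cV[R]_N) :
  entriesI I u = entriesI I v <-> forall i, i \in I -> u i 0 = v i 0.
Proof.
split=> [/colP e i iI|e].
  by have := e (enum_rank_in iI i); rewrite !mxE enum_rankK_in.
by apply/colP => k; rewrite !mxE e // enum_valP.
Qed.

Lemma colsI_tr_mul (R : realType) (n N : nat) (I : {set 'I_N})
    (D : 'M[R]_(n, N)) (x : 'cV[R]_n) :
  (colsI I D)^T *m x = entriesI I (D^T *m x).
Proof. by apply/colP => k; rewrite !mxE; apply: eq_bigr => j _; rewrite !mxE. Qed.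

Lemma vsign_entriesI (R : realType) (N : nat) (I : {set 'I_N}) (z : 'cV[R]_N) :
  vsign (entriesI I z) = entriesI I (vsign z).
Proof. by apply/colP => k; rewrite !mxE. Qed.

Lemma colker_colsI (R : realType) (n N : nat) (I : {set 'I_N})
    (D : 'M[R]_(n, N)) (x : 'cV[R]_n) :
  colker (colsI I D)^T x <-> forall i, i \in I -> (D^T *m x) i 0 = 0.
Proof.
rewrite /colker /= colsI_tr_mul.
have -> : 0 = entriesI I (0 : 'cV[R]_N) by apply/colP => k; rewrite !mxE.
rewrite entriesI_eqP; by split=> H i /H ->; rewrite mxE.
Qed.

Lemma norm1_vsupp (R : realType) (N : nat) (z : 'cV[R]_N) :
  norm1 z = \sum_(i in vsupp z) Num.sg (z i 0) * z i 0.
Proof.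
rewrite /norm1 (bigID [in vsupp z]) /= [X in _ + X]big1 ?addr0.
  by apply: eq_bigr => i _; exact: normrEsg.
by move=> i; rewrite inE negbK => /eqP ->; rewrite normr0.
Qed.

(** For small [t] no entry on the support changes sign, and off the support the new entries are
    [t g i]; hence an exact identity instead of a limit. *)
Lemma norm1_dir_deriv (R : realType) (N : nat) (z g : 'cV[R]_N) :
  exists2 t, 0 < t & norm1 (z + t *: g) = norm1 z +
    t * (\sum_(i in vsupp z) Num.sg (z i 0) * g i 0
         + \sum_(i in ~: vsupp z) `|g i 0|).
Proof.
have [i|t t0 Ht] := @exists_small_scale R _ [in vsupp z]
    (fun i => z i 0) (fun i => g i 0).
  by rewrite inE.
exists t => //; rewrite (norm1_vsupp R N z) /norm1 (bigID [in vsupp z]) /=.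
rewrite mulrDr addrA !mulr_sumr -big_split /=; congr (_ + _).
  apply: eq_bigr => i iI; rewrite !mxE norm_perturb ?Ht // normrEsg.
  by rewrite mulrCA.
apply: eq_big => [i|i]; first by rewrite finset.in_setC.
rewrite inE negbK !mxE => /eqP ->.
by rewrite add0r normrM gtr0_norm.
Qed.

Theorem theorem3p2 (R : realType) (m n N : nat)
    (A : 'M[R]_(m, n)) (D : 'M[R]_(n, N)) (xs : 'cV[R]_n) (I : {set 'I_N})
    (hmn : (m < n)%N) (hI : I = vsupp (D^T *m xs)) :
  is_unique_minimizer [set y : 'cV[R]_n | A *m y = A *m xs]%classic
    (fun y : 'cV[R]_n => norm1 (D^T *m y)) xs
  <->
  (colker A `&` colker (colsI (~: I) D)^T = [set 0])%classic
  /\ exists (w : 'cV[R]_m) (v : 'cV[R]_N),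
       [/\ D *m v = A^T *m w,
           entriesI I v = vsign ((colsI I D)^T *m xs)
         & norm_inf (entriesI (~: I) v) < 1].
Proof.
set z := D^T *m xs in hI *.
split.

(* Necessity: uniqueness gives the kernel condition and the certificate *)
- move=> [[_ minx] uniqx].
  have pos (h : 'cV[R]_n) : A *m h = 0 -> h != 0 ->
      0 < \sum_(i in I) Num.sg (z i 0) * (D^T *m h) i 0
          + \sum_(i in ~: I) `|(D^T *m h) i 0|.
    move=> Ah h0; rewrite hI; have [t t0 e] := norm1_dir_deriv R N z (D^T *m h).
    rewrite -(pmulr_rgt0 _ t0) -(ltrDl (norm1 z)) -e.
    have zE : D^T *m (xs + t *: h) = z + t *: (D^T *m h).
      by rewrite mulmxDr -scalemxAr.
    (* Otherwise [xs + t *: h] would be a minimizer too, forcing [h = 0]. *)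
    rewrite ltNge; apply: contra_neqN h0 => le.
    have : xs + t *: h = xs.
      apply: uniqx; split; first by rewrite /= mulmxDr -scalemxAr Ah scaler0 addr0.
      by move=> y /minx; apply: le_trans; rewrite zE.
    move/eqP; rewrite -subr_eq0 addrC addKr scaler_eq0 gt_eqF //=.
    by move/eqP.
  split.
    apply/seteqP; split => h /=; last first.
      by move=> ->; split; rewrite /colker /= mulmx0.
    (* For such an [h] only the linear part of [pos] remains, and it cannot be positive at both [h]
       and [- h]. *)
    move=> [Ah /colker_colsI hIc]; apply: boolp.contrapT => /eqP h0.
    have q0 : \sum_(i in ~: I) `|(D^T *m h) i 0| = 0.
      by apply: big1 => i /hIc ->; rewrite normr0.
    have gN i : (D^T *m - h) i 0 = - (D^T *m h) i 0.
      by rewrite mulmxN [LHS]mxE.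
    have := pos h Ah h0.
    have := pos (- h); rewrite mulmxN Ah oppr0 oppr_eq0 => /(_ erefl h0).
    have -> : \sum_(i in ~: I) `|(D^T *m - h) i 0| =
              \sum_(i in ~: I) `|(D^T *m h) i 0|.
      by apply: eq_bigr => i _; rewrite gN normrN.
    have -> : \sum_(i in I) Num.sg (z i 0) * (D^T *m - h) i 0 =
              - \sum_(i in I) Num.sg (z i 0) * (D^T *m h) i 0.
      by rewrite -sumrN; apply: eq_bigr => i _; rewrite gN mulrN.
    rewrite q0; lra.
  (* The rows of the square matrix [kermx A^T] may be dependent; with a row basis, [B^T *m c] is
     nonzero whenever [c] is. *)
  pose B := row_base (kermx A^T).
  have AB : A *m B^T = 0.
    apply: trmx_inj; rewrite trmx_mul trmxK trmx0; apply/eqP.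
    by rewrite -sub_kermx eq_row_base.
  have [c c0|v [vI vIc vM]] := @strict_sign_kernel R _ N (D^T *m B^T) I
      (fun i => Num.sg (z i 0)).
    rewrite -mulmxA; apply: pos; first by rewrite mulmxA AB mul0mx.
    apply: contraNneq c0 => /(congr1 trmx); rewrite trmx_mul trmxK trmx0 => e.
    rewrite -[c]trmxK; have -> : c^T = 0; last by rewrite trmx0.
    by apply: (row_free_inj (row_base_free (kermx A^T))); rewrite mul0mx.
  have : (v *m D^T <= A)%MS.
    apply: mulmx_kermx_tr.
    have /submxP[E ->] : (kermx A^T <= B)%MS by rewrite eq_row_base.
    by rewrite trmx_mul mulmxA -(mulmxA v) vM mul0mx.
  case/submxP => w wE; exists w^T, v^T; split.
  + by rewrite -trmx_mul -wE trmx_mul trmxK.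
  + rewrite colsI_tr_mul vsign_entriesI; apply/entriesI_eqP => i iI.
    by rewrite !mxE vI // mxE.
  + apply/norm_inf_lt => // k; rewrite !mxE; apply: vIc; exact: enum_valP.

(* Sufficiency: the certificate bounds the objective strictly from below *)
- move=> [ker0 [w [v [Dv vI vIc]]]].
  have vs i : i \in I -> v i 0 = Num.sg (z i 0).
    move=> iI; move: vI; rewrite colsI_tr_mul vsign_entriesI.
    by move=> /entriesI_eqP/(_ i iI); rewrite mxE.
  have v1 i : i \in ~: I -> `|v i 0| < 1.
    move=> iI; have /norm_inf_lt := vIc => /(_ ltr01 (enum_rank_in iI i)).
    by rewrite mxE enum_rankK_in.
  have strict y : A *m y = A *m xs -> y != xs -> norm1 z < norm1 (D^T *m y).
    move=> Ay yx; pose h := y - xs; pose g := D^T *m h.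
    have Ah : A *m h = 0 by rewrite mulmxBr Ay subrr.
    have yE i : (D^T *m y) i 0 = z i 0 + g i 0.
      have -> : D^T *m y = z + g by rewrite /g mulmxBr addrC subrK.
      by rewrite [LHS]mxE.
    (* The certificate is orthogonal to feasible directions:
       [<v, D^T h> = <D v, h> = <w, A h> = 0]. *)
    have vg : \sum_i v i 0 * g i 0 = 0.
      have <- : (v^T *m g) 0 0 = \sum_i v i 0 * g i 0.
        by rewrite mxE; apply: eq_bigr => i _; rewrite [v^T _ _]mxE.
      by rewrite mulmxA -trmx_mul Dv trmx_mul trmxK -mulmxA Ah mulmx0 mxE.
    have z0 i : i \in ~: I -> z i 0 = 0.
      by rewrite inE hI inE negbK => /eqP.
    (* If [g] vanished off [I], then [h] would lie in both kernels and be 0. *)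
    have [j jI gj] : exists2 j, j \in ~: I & g j 0 != 0.
      apply/exists_inP; apply: contraT; rewrite negb_exists_in => /forall_inP H.
      case/eqP: yx; apply/eqP; rewrite -subr_eq0 -/h; apply/eqP.
      have : (colker A `&` colker (colsI (~: I) D)^T)%classic h.
        split=> //; apply/colker_colsI => i /H; rewrite negbK => /eqP; exact.
      by rewrite ker0.
    rewrite -subr_gt0.
    (* Subtracting the zero sum [vg] makes every summand nonnegative, and the one at [j] positive
       because [|v j| < 1]. *)
    have -> : norm1 (D^T *m y) - norm1 z =
        \sum_i (`|(D^T *m y) i 0| - `|z i 0| - v i 0 * g i 0).
      by rewrite !sumrB vg subr0.
    rewrite (bigD1 j) //= ltr_pwDl //.
      rewrite yE z0 // normr0 subr0 add0r subr_gt0.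
      apply: le_lt_trans (ler_norm _) _; rewrite normrM.
      by rewrite gtr_pMl ?normr_gt0 // v1.
    apply: sumr_ge0 => i _; rewrite yE.
    have [iI|iI] := boolP (i \in I).
      rewrite vs // [`|z i 0|]normrEsg.
      have : Num.sg (z i 0) * (z i 0 + g i 0) <= `|z i 0 + g i 0|.
        apply: le_trans (ler_norm _) _; rewrite normrM normr_sg.
        by case: (_ != 0); rewrite ?mul1r ?mul0r.
      rewrite mulrDr; lra.
    rewrite z0 ?inE // normr0 subr0 add0r subr_ge0.
    apply: le_trans (ler_norm _) _; rewrite normrM ler_piMl //.
    by apply/ltW/v1; rewrite inE.
  split; first split=> // y Ay.
    have [->|yx] := eqVneq y xs; [exact: lexx|exact/ltW/strict].
  move=> y [Ay miny]; apply/eqP; apply: contraT => yx.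
  by have := miny xs erefl; rewrite leNgt strict.
Qed.
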